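(* For positive integers $n$ and non-negative integers $T,E$, let $F_n[T,E]$ denote the number of sequences $(s_1,\dots,s_n)$ of non-negative integers such that $s_1\le s_2\le\cdots\le s_n$, $\sum_{i=1}^r s_i\ge\binom{r}{2}$ for all $1\le r<n$, $s_n=E$, and $\sum_{i=1}^n s_i=T$. Let $SCS(n)$ denote the number of self-complementary score sequences of length $n$. Then for all integers $m\ge 1$, $$SCS(2m)=\sum_{T=\binom{m}{2}}^{m(m-1)}\ \sum_{E=\lceil T/m\rceil}^{m-1} F_m[T,E],$$ and $$SCS(2m+1)=\sum_{T=\binom{m}{2}}^{m^2}\ \sum_{E=\lceil T/m\rceil}^{m} F_m[T,E].$$
   Context: A score sequence of length $n\ge1$ is a sequence $(s_1,\dots,s_n)$ of non-negative integers with $s_1\le\cdots\le s_n$ that is the sequence of out-degrees (scores) of some tournament (orientation of the complete graph) on $n$ vertices, listed in nondecreasing order; equivalently (Landau), $\sum_{i=1}^r s_i\ge\binom r2$ for $1\le r<n$ and $\sum_{i=1}^n s_i=\binom n2$. A score sequence of length $n$ is called self-complementary if $s_{n+1-i}=n-1-s_i$ for all $1\le i\le\lfloor n/2\rfloor$. *)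

(* Defs.v *)
From mathcomp Require Import all_boot.

Set Implicit Arguments.
Unset Strict Implicit.
Unset Printing Implicit Defensive.

(* Sequences are indexed from 0: the informal s_i is [nth 0 s i.-1]. *)

(* A tournament on 'I_n, given by its set of arcs: (i, j) \in A means i -> j. *)
Definition is_tournament (n : nat) (A : {set 'I_n * 'I_n}) : bool :=
  [forall i, (i, i) \notin A] &&
  [forall i, forall j, (i != j) ==> ((i, j) \in A) (+) ((j, i) \in A)].

Definition score (n : nat) (A : {set 'I_n * 'I_n}) (i : 'I_n) : nat :=
  #|[set j | (i, j) \in A]|.

Definition is_score_sequence (n : nat) (s : seq nat) : bool :=
  sorted leq s &&
  [exists A : {set 'I_n * 'I_n},
     is_tournament A && perm_eq s [seq score A i | i <- enum 'I_n]].

(* Written additively, so that no truncated subtraction hides the condition. *)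
Definition self_complementary (n : nat) (s : seq nat) : bool :=
  [forall i : 'I_(n./2), nth 0 s (n - i.+1) + nth 0 s i == n - 1].

Definition is_scs (n : nat) (s : seq nat) : bool :=
  is_score_sequence n s && self_complementary n s.

Definition is_F (n T E : nat) (s : seq nat) : bool :=
  [&& size s == n, sorted leq s,
      [forall r : 'I_n, (0 < r) ==> ('C(r, 2) <= \sum_(i < r) nth 0 s i)],
      nth 0 s n.-1 == E & \sum_(i < n) nth 0 s i == T].

Definition count_seqs (n b : nat) (P : pred (seq nat)) : nat :=
  #|[set t : n.-tuple 'I_b | P [seq val x | x <- t]]|.

(* The bound n on the entries loses nothing, see [SCSP]. *)
Definition SCS (n : nat) : nat := count_seqs n n (is_scs n).

(* The bound E.+1 on the entries loses nothing, see [FP]. *)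
Definition F (n T E : nat) : nat := count_seqs n E.+1 (is_F n T E).

Definition ceil_div (T m : nat) : nat := (T + m.-1) %/ m.

Lemma ceil_divP (T m k : nat) : 0 < m -> (ceil_div T m <= k) = (T <= k * m).
Proof.
case: m => // m _.
by rewrite /ceil_div /= -ltnS ltn_divLR // mulSn addSn addnC ltnS leq_add2l.
Qed.

Lemma count_seqsP (n b : nat) (P : pred (seq nat)) :
  (forall s, P s -> size s = n /\ {in s, forall x, x < b}) ->
  exists l : seq (seq nat),
    [/\ uniq l, forall s, (s \in l) = P s & size l = count_seqs n b P].
Proof.
move=> bP; pose f (t : n.-tuple 'I_b) := [seq val x | x <- t].
exists [seq f t | t <- enum [set t | P (f t)]]; split.
- rewrite map_inj_uniq ?enum_uniq // => t u /(inj_map val_inj) tu.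
  exact: val_inj.
- move=> s; apply/mapP/idP => [[t]|Ps]; first by rewrite mem_enum inE => ? ->.
  have [sz_s lt_s] := bP s Ps.
  have Es : [seq val x | x <- pmap (insub : nat -> option 'I_b) s] = s.
    rewrite -[RHS](filter_predT s) pmap_filter; last exact: insubK.
    apply: eq_in_filter => x /lt_s x_lt /=; by rewrite insubT.
  have sz : size (pmap (insub : nat -> option 'I_b) s) == n.
    by rewrite -sz_s -[in X in _ == X]Es size_map.
  exists (Tuple sz); last by rewrite /f /= Es.
  by rewrite mem_enum inE /f /= Es.
- by rewrite size_map -cardE.
Qed.

Lemma SCSP (n : nat) : exists l : seq (seq nat),
  [/\ uniq l, forall s, (s \in l) = is_scs n s & size l = SCS n].
Proof.
apply: count_seqsP => s /andP[/andP[_ /existsP[A /andP[tA pA]]] _].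
split; first by rewrite (perm_size pA) size_map size_enum_ord.
move=> x; rewrite (perm_mem pA) => /mapP[i _ ->].
have /andP[/forallP irr _] := tA.
rewrite /score -[X in _ < X](card_ord n); apply: proper_card.
apply/properP; split; first by apply/subsetP.
by exists i; rewrite ?inE // (negPf (irr i)).
Qed.

Lemma FP (n T E : nat) : exists l : seq (seq nat),
  [/\ uniq l, forall s, (s \in l) = is_F n T E s & size l = F n T E].
Proof.
apply: count_seqsP => s /and5P[/eqP sz srt _ /eqP lastE _]; split=> // x xs.
have i_lt : index x s < size s by rewrite index_mem.
rewrite ltnS -lastE -(nth_index 0 xs).
apply: (sorted_leq_nth leq_trans leqnn) => //; rewrite ?inE -?sz //.
  by rewrite prednK // (leq_trans _ i_lt).
by rewrite -ltnS prednK // (leq_trans _ i_lt).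
Qed.

(* Main.v *)
Require Import Defs.
From mathcomp Require Import all_boot perm zify.

(** The sufficiency part of Landau's theorem: take a tournament with the least
    total deficit [\sum_i (s_i - score_i)]. If some vertex [i] has too large a
    score and a vertex reachable from [i] has too small a score, reversing a
    path between them decreases the deficit. Otherwise the set [X] of vertices
    reachable from [i] has no outgoing arc, so its scores add up to
    ['C(#|X|, 2)]; but they dominate [s] on [X], strictly at [i], so that [s]
    violates Landau's inequality on [X].

    For the count, a self-complementary score sequence of length [n] is
    determined by its first half (when [n] is odd, the middle entry is forced by
    the total). Landau's inequality for the first [r > n/2] entries is, by
    complementation, the one for the first [n - r] entries, so the only
    conditions on the half are Landau's and, for monotonicity, that its last
    entry [E] is at most [(n - 1)/2]; summing over [E] and the total [T] loses
    nothing because [T <= (n/2) E] for a nondecreasing half. *)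

(** * Arc counts and path reversal in tournaments *)

Lemma mulnn1_bin2 n : n * n.-1 = 2 * 'C(n, 2).
Proof. by rewrite -mul_bin_diag bin1. Qed.

Lemma is_tournamentP {n} (A : {set 'I_n * 'I_n}) :
  reflect (forall i j, ((i, j) \in A) + ((j, i) \in A) = (i != j))
          (is_tournament A).
Proof.
apply: (iffP andP) => [[/forallP irr /forallP tot] i j | tot].
  have [<- | neq] := eqVneq i j; first by rewrite (negPf (irr i)).
  by have := implyP (forallP (tot i) j) neq; do 2 case: (_ \in A).
split; first by apply/forallP => i; have := tot i i; rewrite eqxx; case: (_ \in A).
apply/forallP => i; apply/forallP => j; apply/implyP => neq.
by have := tot i j; rewrite neq; do 2 case: (_ \in A).
Qed.

Lemma scoreE {n} (A : {set 'I_n * 'I_n}) i : score A i = \sum_j ((i, j) \in A).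
Proof.
by rewrite /score -sum1_card big_mkcond; apply: eq_bigr => j _; rewrite inE; case: ifP.
Qed.

(** Adding the sum to its transpose counts each ordered pair of distinct vertices of [X] once, which
    gives [#|X| * #|X|.-1]. *)
Lemma tournament_arcs_within {n} (A : {set 'I_n * 'I_n}) (X : {set 'I_n}) :
  is_tournament A ->
  \sum_(i in X) \sum_(j in X) ((i, j) \in A) = 'C(#|X|, 2).
Proof.
move=> /is_tournamentP tA; apply/eqP; rewrite -(eqn_pmul2l (ltn0Sn 1)); apply/eqP.
rewrite -mulnn1_bin2 mul2n -addnn [X in _ + X = _]exchange_big -big_split /=.
rewrite -sum_nat_const; apply: eq_bigr => i iX.
rewrite -big_split /= (cardsD1 i X) iX add1n /=.
rewrite -sum1_card big_mkcond [RHS]big_mkcond /=; apply: eq_bigr => j _.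
by rewrite tA !inE eq_sym; case: (j == i); case: (j \in X).
Qed.

Lemma sum_scores {n} (A : {set 'I_n * 'I_n}) :
  is_tournament A -> \sum_i score A i = 'C(n, 2).
Proof.
move=> tA; rewrite -[in RHS](card_ord n) -cardsT -(tournament_arcs_within A setT tA).
under [RHS]eq_bigl do rewrite inE.
by apply: eq_bigr => i _; rewrite scoreE; apply: eq_bigl => j; rewrite inE.
Qed.

(* [B] is [A] with the path reversed. *)
Lemma tournament_shift_score {n} (A : {set 'I_n * 'I_n}) x p :
  is_tournament A -> path (fun i j => (i, j) \in A) x p -> uniq (x :: p) ->
  exists2 B : {set 'I_n * 'I_n}, is_tournament B &
    forall i, score B i + (i == x) = score A i + (i == last x p).
Proof.
elim: p x A => [|y p IH] x A tA; first by exists A.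
move=> /= /andP[xyA yp] /andP[xyp uyp].
have /is_tournamentP tot := tA.
have neq_xy : x != y by apply: contraNneq xyp => ->; rewrite mem_head.
have yxA : (y, x) \notin A by have := tot x y; rewrite xyA neq_xy; case: (_ \in A).
(* Only the first arc is reversed here; the induction hypothesis, applied to [B], reverses the
   rest. *)
pose B := (y, x) |: A :\ (x, y).
have inB i j : ((i, j) \in B) + ((i == x) && (j == y))
             = ((i, j) \in A) + ((i == y) && (j == x)).
  rewrite !inE !xpair_eqE.
  have [-> | nix] := eqVneq i x; have [-> | njy] := eqVneq j y;
    rewrite ?eqxx ?(negPf neq_xy) ?xyA //=.
  - have [eq_yx | _] := eqVneq y x; first by rewrite eq_yx eqxx in neq_xy.
    by rewrite andbF addn0.
  - have [-> | _] := eqVneq i y; have [-> | _] := eqVneq j x;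
      by rewrite ?(negPf yxA) //= addn0.
have tB : is_tournament B.
  apply/is_tournamentP => i j; have := inB i j; have := inB j i; have := tot i j.
  rewrite [(j == x) && _]andbC [(j == y) && _]andbC.
  move: (((i, j) \in A) : nat) (((j, i) \in A) : nat) => a a'.
  move: (((i, j) \in B) : nat) (((j, i) \in B) : nat) => b b'.
  by move: (nat_of_bool (_ && _)) (nat_of_bool (_ && _)) => c c'; lia.
have scB i : score B i + (i == x) = score A i + (i == y).
  have sumE (a b c : 'I_n) : \sum_j ((a == b) && (j == c)) = (a == b).
    rewrite (bigD1 c) //= eqxx andbT big1 ?addn0 // => j /negPf->.
    by rewrite andbF.
  rewrite !scoreE -(sumE i x y) -(sumE i y x) -!big_split /=.
  exact: eq_bigr.
(* The rest of the path avoids [x], so its arcs survive in [B]. *)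
have pB : path (fun i j => (i, j) \in B) y p.
  apply: (sub_in_path (P := [in y :: p])) (yp); last exact/allP.
  move=> i j; rewrite !inE /= -!in_cons => iyp jyp ijA.
  have ix : i != x by apply: contraNneq xyp => <-.
  by rewrite ijA !xpair_eqE negb_and ix orbT.
have [C tC scC] := IH y B tB pB uyp.
exists C => // i; apply/eqP.
by rewrite -(eqn_add2r (i == y)) addnAC scC addnAC scB addnAC.
Qed.

(** * Landau's theorem *)

(** Landau's inequality is assumed for all sets of vertices because the set of reachable vertices is
    arbitrary. *)
Lemma tournament_of_scores {n} (s : 'I_n -> nat) :
  (forall X : {set 'I_n}, 'C(#|X|, 2) <= \sum_(i in X) s i) ->
  \sum_i s i = 'C(n, 2) ->
  exists2 A : {set 'I_n * 'I_n}, is_tournament A & score A =1 s.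
Proof.
move=> landau total.
have t0 : is_tournament [set ij : 'I_n * 'I_n | ij.1 < ij.2].
  apply/is_tournamentP => i j; rewrite !inE /= -val_eqE /=; lia.
(* The subtraction is truncated, so only vertices with too small a score contribute. *)
pose deficit (A : {set 'I_n * 'I_n}) := \sum_i (s i - score A i).
have [A tA Amin] := arg_minnP deficit t0.
have sumA : \sum_i score A i = \sum_i s i by rewrite total sum_scores.
(* Both sides have the same total, so a pointwise inequality forces equality. *)
have le_all i : score A i <= s i; last first.
  exists A => // i; apply/eqP.
  have /leqif_sum[_] : forall j, true -> score A j <= s j ?= iff (score A j == s j).
    by move=> j _; split.
  by rewrite sumA eqxx => /esym /forallP /(_ i).
rewrite leqNgt; apply/negP => lt_i.
pose X := [set j | connect (fun j k => (j, k) \in A) i j].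
have iX : i \in X by rewrite inE connect0.
have geX j : j \in X -> s j <= score A j.
  rewrite inE => /connectP[p ip ->]; rewrite leqNgt; apply/negP.
  case: (shortenP ip) => q iq uq _ lt_q.
  have [B tB scB] := tournament_shift_score A i q tA iq uq.
  suff: deficit B < deficit A by rewrite ltnNge Amin.
  rewrite /deficit (bigD1 (last i q)) //= [X in _ < X](bigD1 (last i q)) //=.
  have := scB (last i q); rewrite eqxx.
  have [eq_i | _] := eqVneq (last i q) i; first by move: lt_q; rewrite eq_i; lia.
  rewrite addn0 addn1 => scl; rewrite -addSn leq_add //.
    by rewrite scl ltn_sub2l.
  apply: leq_sum => k /negPf neq; have := scB k; rewrite neq addn0.
  (* The score of [i] was too large, so after losing one arc its truncated deficit is still 0. *)
  have [->|_] := eqVneq k i; last by rewrite addn0 => ->.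
  rewrite addn1 => scBi; suff /eqP-> : s i - score B i == 0 by [].
  by rewrite subn_eq0 -ltnS scBi.
have outX j k : j \in X -> k \notin X -> (j, k) \notin A.
  rewrite !inE => ij; apply: contra => jk.
  by apply: connect_trans ij _; apply: connect1.
have scX : \sum_(j in X) score A j = 'C(#|X|, 2).
  rewrite -(tournament_arcs_within A X tA); apply: eq_bigr => j jX.
  rewrite scoreE [RHS]big_mkcond; apply: eq_bigr => k _.
  by case: ifPn => // kX; rewrite (negPf (outX _ _ jX kX)).
have := landau X; rewrite -scX leqNgt => /negP; apply.
rewrite (bigD1 i) //= [X in _ < X](bigD1 i) //= -addSn leq_add //.
by apply: leq_sum => j /andP[/geX].
Qed.

(** Outside their intersection, [X] and the initial segment [K] have equally many indices, and
    [s k.-1] separates the values on the two differences. *)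
Lemma sum_first_le_sum_set {n} (s : nat -> nat) (X : {set 'I_n}) :
  (forall i j, i <= j < n -> s i <= s j) ->
  \sum_(i < #|X|) s i <= \sum_(i in X) s i.
Proof.
move=> s_mono; set k := #|X|.
have le_kn : k <= n by rewrite -[n]card_ord max_card.
pose K := [set i : 'I_n | i < k].
have cardK : #|K| = k.
  rewrite -sum1_card (eq_bigl (fun i : 'I_n => i < k)); last by move=> i; rewrite inE.
  by rewrite -(big_ord_widen n (fun=> 1)) // sum1_card card_ord.
have -> : \sum_(i < k) s i = \sum_(i in K) s i.
  by rewrite (big_ord_widen n) //; apply: eq_bigl => i; rewrite inE.
rewrite (big_setID X) [X in _ <= X](big_setID K) /= setIC leq_add2l.
have cardD : #|K :\: X| = #|X :\: K|.
  by apply/eqP; rewrite -(eqn_add2l #|K :&: X|) cardsID cardK setIC cardsID.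
apply: (@leq_trans (#|K :\: X| * s k.-1)).
  rewrite -sum_nat_const; apply: leq_sum => i; rewrite !inE => /andP[_ ik].
  apply: s_mono; lia.
rewrite cardD -sum_nat_const; apply: leq_sum => i; rewrite !inE => /andP[ik _].
by apply: s_mono; move: (ltn_ord i); lia.
Qed.

Theorem landau n s :
  is_score_sequence n s =
  [&& size s == n, sorted leq s,
      [forall r : 'I_n, 'C(r, 2) <= \sum_(i < r) nth 0 s i]
    & \sum_(i < n) nth 0 s i == 'C(n, 2)].
Proof.
have scA_lower (A : {set 'I_n * 'I_n}) (X : {set 'I_n}) : is_tournament A ->
    'C(#|X|, 2) <= \sum_(i in X) score A i.
  move=> tA; rewrite -(tournament_arcs_within A X tA); apply: leq_sum => i _.
  rewrite scoreE big_mkcond; apply: leq_sum => j _; by case: ifP.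
apply/andP/and4P => [[srt /existsP[A /andP[tA pA]]] | [/eqP sz srt]].
  have sz : size s = n by rewrite (perm_size pA) size_map size_enum_ord.
  have [p Ep] : exists p : {perm 'I_n}, forall i : 'I_n, nth 0 s i = score A (p i).
    pose t := [tuple score A i | i < n].
    have /tuple_permP[p Ep] : perm_eq s t by [].
    exists p => i; by rewrite Ep -tnth_nth !tnth_mktuple.
  split=> //; first exact/eqP.
    (* The first [r] entries are the scores of [r] vertices, and the arcs among these already number
       ['C(r, 2)]. *)
    apply/forallP => r; pose X := [set p i | i in [pred i : 'I_n | i < r]].
    have cX : #|X| = r.
      rewrite card_imset; last exact: perm_inj.
      by rewrite -sum1_card -(big_ord_widen n (fun=> 1)) ?sum1_card ?card_ord // ltnW.
    rewrite -[in X in X <= _]cX (leq_trans (scA_lower A X tA)) //.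
    rewrite big_imset /=; last by move=> i j _ _; apply: perm_inj.
    rewrite (big_ord_widen n (nth 0 s)) ?(ltnW (ltn_ord r)) //.
    by rewrite leq_eqVlt; apply/orP; left; apply/eqP; apply: eq_bigr => i _.
  apply/eqP; under eq_bigr do rewrite Ep.
  by rewrite -(sum_scores A tA) [RHS](reindex_inj (@perm_inj _ p)).
move=> /forallP partial /eqP total; split=> //.
have mono i j : i <= j < n -> nth 0 s i <= nth 0 s j.
  move=> /andP[ij jn]; apply: (sorted_leq_nth leq_trans leqnn) => //;
    by rewrite inE sz // (leq_ltn_trans ij).
have [|//|A tA scA] := tournament_of_scores (fun i : 'I_n => nth 0 s i).
  move=> X; apply: leq_trans (sum_first_le_sum_set (nth 0 s) X mono).
  have: #|X| <= n by rewrite -[X in _ <= X]card_ord max_card.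
  rewrite leq_eqVlt => /predU1P[->|lt]; first by rewrite total.
  exact: (partial (Ordinal lt)).
apply/existsP; exists A; rewrite tA /=.
suff -> : [seq score A i | i <- enum 'I_n] = s by [].
rewrite (eq_map scA) (map_comp (nth 0 s) val) val_enum_ord -/(mkseq _ _) -sz.
exact: mkseq_nth.
Qed.

(** * Counting inside a common list *)

(** The tuple types behind [F] change with [E]; this moves all the counts to one list, where sums
    can be exchanged. *)
Lemma count_seqs_count {n b} {P : pred (seq nat)} {L : seq (seq nat)} :
  (exists l, [/\ uniq l, forall s, (s \in l) = P s & size l = count_seqs n b P]) ->
  uniq L -> {subset P <= L} -> count_seqs n b P = count P L.
Proof.
case=> l [ul lP <-] uL PL; rewrite -size_filter; apply: perm_size.
apply: uniq_perm => // [|s]; first exact: filter_uniq.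
rewrite lP mem_filter; case Ps: (P s) => //=; exact/esym/PL.
Qed.

(** Only [T] equal to the sum of [s] and [E] equal to its last entry can contribute. The lower limit
    on [E] is then automatic, since [m] times the last entry bounds the sum of a sorted [s]. *)
Lemma sum_is_F m a b c s :
  0 < m -> size s = m ->
  \sum_(a <= T < b) \sum_(ceil_div T m <= E < c) is_F m T E s =
  [&& sorted leq s,
      [forall r : 'I_m, 'C(r, 2) <= \sum_(i < r) nth 0 s i],
      a <= \sum_(i < m) nth 0 s i < b
    & nth 0 s m.-1 < c] :> nat.
Proof.
move=> m_gt0 sz; set t := \sum_(i < m) _; set e := nth 0 s m.-1.
set lan := [forall r, _].
have isF T E : is_F m T E s = (T == t) && ((E == e) && (sorted leq s && lan)).
  rewrite /is_F sz eqxx /= [_ == E]eq_sym [_ == T]eq_sym -/t -/e.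
  have -> : [forall r : 'I_m, (0 < r) ==> ('C(r, 2) <= \sum_(i < r) nth 0 s i)] = lan.
    apply: eq_forallb => -[[|r] ltr] //=; by rewrite bin0n.
  by case: (T == t); case: (E == e); rewrite ?andbT ?andbF.
have inner T : \sum_(ceil_div T m <= E < c) is_F m T E s =
    if T == t then if ceil_div T m <= e < c then nat_of_bool (sorted leq s && lan) else 0 else 0.
  under eq_bigr do rewrite isF.
  case: eqP => [_|_]; last by rewrite big1.
  rewrite -(big_nat1_eq addn (fun=> nat_of_bool (sorted leq s && lan))) big_mkcond /=.
  by apply: eq_bigr => E _; case: eqP.
under eq_bigr do rewrite inner.
rewrite -big_mkcond big_nat1_eq /=.
have [srt | _] := boolP (sorted leq s); last by rewrite /= !if_same.
have -> : ceil_div t m <= e.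
  rewrite ceil_divP // mulnC -[m in m * _]card_ord -sum_nat_const /t.
  apply: leq_sum => i _; apply: (sorted_leq_nth leq_trans leqnn) => //;
    by move: (ltn_ord i); rewrite ?inE ?sz; lia.
by case: (_ <= t < b); case: (e < c); rewrite /= ?andbT ?andbF.
Qed.

(** * Self-complementary sequences and their first halves *)

(** Unlike [self_complementary], this also constrains the middle entry when [n] is odd. *)
Definition complemented n (s : seq nat) :=
  forall i, i < n -> nth 0 s i + nth 0 s (n - i.+1) = n.-1.

Lemma double_sum_rev n (s : seq nat) :
  2 * \sum_(i < n) nth 0 s i = \sum_(i < n) (nth 0 s i + nth 0 s (n - i.+1)).
Proof.
by rewrite mul2n -addnn [X in _ + X](reindex_inj rev_ord_inj) -big_split.
Qed.

Lemma scs_complemented {n s} : is_scs n s -> complemented n s.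
Proof.
move=> /andP[]; rewrite landau => /and4P[_ _ _ /eqP total] /forallP compl.
have low i : i < n./2 -> nth 0 s i + nth 0 s (n - i.+1) = n.-1.
  by move=> lti; have /eqP := compl (Ordinal lti); rewrite /= addnC subn1.
have off_middle i : i < n -> i != n - i.+1 -> nth 0 s i + nth 0 s (n - i.+1) = n.-1.
  move=> ltin mid; have [|ge] := ltnP i n./2; first exact: low.
  have lt : n - i.+1 < n./2 by lia.
  by rewrite -(low _ lt) addnC; congr (_ + nth 0 s _); lia.
move=> i ltin; have [mid | ] := eqVneq i (n - i.+1); last exact: off_middle.
(* The middle entry is forced by the total. *)
have := double_sum_rev n s; rewrite total -mulnn1_bin2 (bigD1 (Ordinal ltin)) //=.
rewrite (eq_bigr (fun=> n.-1)) => [|j neq_j]; last first.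
  by apply: off_middle => //; move: neq_j; rewrite -val_eqE /=; lia.
rewrite sum_nat_const cardC1 card_ord; case: n ltin {total compl low off_middle mid} => // n _.
by rewrite mulSn /= => /eqP; rewrite eqn_add2r => /eqP.
Qed.

Lemma complemented_scs n s :
  size s = n -> sorted leq s -> complemented n s ->
  (forall r, r <= n./2 -> 'C(r, 2) <= \sum_(i < r) nth 0 s i) ->
  is_scs n s.
Proof.
move=> sz srt compl partial; apply/andP; split; last first.
  apply/forallP => i; rewrite addnC compl ?subn1 //.
  by have := ltn_ord i; lia.
have total : \sum_(i < n) nth 0 s i = 'C(n, 2).
  apply/eqP; rewrite -(eqn_pmul2l (ltn0Sn 1)) double_sum_rev -mulnn1_bin2.
  rewrite -[X in X * _]card_ord -sum_nat_const; apply/eqP.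
  by apply: eq_bigr => i _; apply: compl.
rewrite landau sz srt total !eqxx andbT /=; apply/forallP => -[r ltr] /=.
have [le|gt] := leqP r n./2; first exact: partial.
have split_sum : \sum_(i < r) nth 0 s i + \sum_(i < n - r) nth 0 s (n - i.+1) = 'C(n, 2).
  rewrite -total -!(big_mkord xpredT (nth 0 s)) (@big_cat_nat _ _ _ r 0 n) //= ?(ltnW ltr) //.
  congr (_ + _); rewrite -[in RHS](add0n r) big_addn big_nat_rev /= big_mkord.
  by apply: eq_bigr => i _; congr (nth 0 s _); have := ltn_ord i; lia.
have tail : \sum_(i < n - r) nth 0 s i + \sum_(i < n - r) nth 0 s (n - i.+1) = (n - r) * n.-1.
  rewrite -big_split -[X in X * _]card_ord -sum_nat_const.
  by apply: eq_bigr => i _; apply: compl; have := ltn_ord i; lia.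
have low : 'C(n - r, 2) <= \sum_(i < n - r) nth 0 s i by apply: partial; lia.
(* Eliminating the sum of the last [n - r] entries leaves this identity, doubled so that the
   binomials become products. *)
suff : 2 * 'C(r, 2) + 2 * ((n - r) * n.-1) = 2 * 'C(n, 2) + 2 * 'C(n - r, 2).
  have arith a b c x y z p : x + z = a -> y + z = p -> c <= y ->
      2 * b + 2 * p = 2 * a + 2 * c -> b <= x by lia.
  exact: arith split_sum tail low.
have [d En] : exists d, n = r + d.+1 by exists (n - r).-1; lia.
have -> : n - r = d.+1 by lia.
rewrite -!mulnn1_bin2 En; case: r gt {ltr split_sum tail low En} => [|r] gt; first by [].
by rewrite addSn /=; nia.
Qed.

(** The last branch is reached only at the middle index of an odd [n], where [n./2] is half of
    [n.-1]. *)
Definition complete n (t : seq nat) :=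
  mkseq (fun i => if i < n./2 then nth 0 t i
                  else if n - i.+1 < n./2 then n.-1 - nth 0 t (n - i.+1)
                  else n./2) n.

Lemma take_complete {n t} : size t = n./2 -> take n./2 (complete n t) = t.
Proof.
move=> sz; have le : n./2 <= n by lia.
apply: (@eq_from_nth _ 0); first by rewrite size_takel ?size_mkseq.
move=> i; rewrite size_takel ?size_mkseq // => lti.
by rewrite nth_take // nth_mkseq ?lti // (leq_trans lti).
Qed.

Lemma complete_scs n t :
  size t = n./2 -> sorted leq t -> nth 0 t n./2.-1 <= n.-1./2 ->
  (forall r, r <= n./2 -> 'C(r, 2) <= \sum_(i < r) nth 0 t i) ->
  is_scs n (complete n t).
Proof.
move=> sz srt last_t partial.
have mono i j : i <= j < n./2 -> nth 0 t i <= nth 0 t j.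
  move=> /andP[ij jn]; apply: (sorted_leq_nth leq_trans leqnn) => //;
    by rewrite inE sz // (leq_ltn_trans ij).
have bound i : i < n./2 -> nth 0 t i <= n.-1./2.
  by move=> lti; apply: leq_trans last_t; apply: mono; lia.
have nthE i : i < n -> nth 0 (complete n t) i =
    if i < n./2 then nth 0 t i
    else if n - i.+1 < n./2 then n.-1 - nth 0 t (n - i.+1) else n./2.
  by move=> lti; rewrite nth_mkseq.
apply: complemented_scs; first by rewrite size_mkseq.
- apply/(sortedP 0) => i; rewrite size_mkseq => lti.
  rewrite !nthE //; last exact: ltnW.
  (* Monotonicity of [t] serves within each half, [bound] where the halves meet. *)
  have := mono i i.+1; have := mono (n - i.+2) (n - i.+1).
  have := bound i; have := bound (n - i.+1); have := bound (n - i.+2).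
  move: (nth 0 t i) (nth 0 t i.+1) (nth 0 t (n - i.+1)) (nth 0 t (n - i.+2)) => a b c d.
  by do !case: ifP; lia.
- move=> i lti; rewrite !nthE //; last lia.
  have -> : n - (n - i.+1).+1 = i by lia.
  have := bound i; have := bound (n - i.+1).
  move: (nth 0 t i) (nth 0 t (n - i.+1)) => a b.
  by do !case: ifP; lia.
- move=> r ler; rewrite (leq_trans (partial r ler)) // leq_eqVlt; apply/orP; left.
  apply/eqP/eq_bigr => i _; have := ltn_ord i => lti.
  by rewrite nthE ?ifT //; lia.
Qed.

Lemma take_inj_scs {n} : {in is_scs n &, injective (take n./2)}.
Proof.
move=> s s' sP s'P eq_take.
have szP u : is_scs n u -> size u = n.
  by move=> /andP[]; rewrite landau => /and4P[/eqP].
have low i : i < n./2 -> nth 0 s i = nth 0 s' i.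
  by move=> lti; rewrite -(nth_take _ lti) eq_take nth_take.
have cs := scs_complemented sP; have cs' := scs_complemented s'P.
apply: (@eq_from_nth _ 0); first by rewrite !szP.
move=> i; rewrite (szP _ sP) => lti.
have [/low//|ge] := ltnP i n./2.
have := cs i lti; have := cs' i lti.
have [/low->|ge'] := ltnP (n - i.+1) n./2; first lia.
(* Neither [i] nor its mirror image lies in the first half: [i] is the middle index, and its entry
   doubled is [n.-1]. *)
have -> : n - i.+1 = i by lia.
lia.
Qed.

(** * The count, for both parities at once *)

Lemma SCS_half {n} : 1 < n ->
  SCS n = \sum_('C(n./2, 2) <= T < (n./2 * n.-1./2).+1)
            \sum_(ceil_div T n./2 <= E < n.-1./2.+1) F n./2 T E.
Proof.
move=> n_gt1; have m_gt0 : 0 < n./2 by lia.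
have [l [ul lP <-]] := SCSP n.
pose L := [seq take n./2 s | s <- l].
have uL : uniq L.
  by rewrite map_inj_in_uniq // => s s'; rewrite !lP; apply: take_inj_scs.
have LP t : t \in L -> size t = n./2 /\
  [&& sorted leq t,
      [forall r : 'I_n./2, 'C(r, 2) <= \sum_(i < r) nth 0 t i],
      'C(n./2, 2) <= \sum_(i < n./2) nth 0 t i < (n./2 * n.-1./2).+1
    & nth 0 t n./2.-1 < n.-1./2.+1].
  case/mapP => s; rewrite lP => sP ->.
  have cs := scs_complemented sP; case/andP: sP; rewrite landau.
  move=> /and4P[/eqP sz srt /forallP partial _] _.
  have take_sum r : r <= n./2 ->
      \sum_(i < r) nth 0 (take n./2 s) i = \sum_(i < r) nth 0 s i.
    by move=> le; apply: eq_bigr => i _; rewrite nth_take // (leq_trans (ltn_ord i)).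
  have mono i j : i <= j < n -> nth 0 s i <= nth 0 s j.
    move=> /andP[ij jn]; apply: (sorted_leq_nth leq_trans leqnn) => //;
      by rewrite inE sz // (leq_ltn_trans ij).
  (* This entry is at most its mirror image, and the two add up to [n.-1]. *)
  have last_s : nth 0 s n./2.-1 <= n.-1./2.
    have := cs n./2.-1; have := mono n./2.-1 (n - n./2.-1.+1).
    by move: (nth 0 s n./2.-1) (nth 0 s _) => a b; lia.
  have part r : r <= n./2 -> 'C(r, 2) <= \sum_(i < r) nth 0 s i.
    move=> le; have ltr : r < n by lia.
    exact: (partial (Ordinal ltr)).
  split; first by rewrite size_takel ?sz //; lia.
  rewrite take_sum // nth_take ?prednK // (ltnS (nth _ _ _)) last_s part // andbT.
  apply/and3P; split; first exact: take_sorted.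
    by apply/forallP => r; rewrite take_sum ?part // ltnW.
  rewrite ltnS -[X in X * _]card_ord -sum_nat_const; apply: leq_sum => i _.
  by apply: leq_trans last_s; apply: mono; have := ltn_ord i; lia.
transitivity (\sum_('C(n./2, 2) <= T < (n./2 * n.-1./2).+1)
    \sum_(ceil_div T n./2 <= E < n.-1./2.+1) count (is_F n./2 T E) L).
  (* With the sum over [L] outermost, each half is counted for exactly one pair [T], [E]. *)
  under eq_bigr => T _ do under eq_bigr => E _ do rewrite -sum1_count big_mkcond.
  under eq_bigr do rewrite exchange_big.
  rewrite exchange_big /= -(size_map (take n./2) l) -/L -sum1_size.
  rewrite big_seq [RHS]big_seq; apply: eq_bigr => t /LP[sz tP].
  under [RHS]eq_bigr => T _ do under eq_bigr => E _ do rewrite -mulnbl muln1.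
  by rewrite sum_is_F // tP.
rewrite big_nat [RHS]big_nat; apply: eq_bigr => T /andP[leT _].
rewrite big_nat [RHS]big_nat; apply: eq_bigr => E /andP[_ leE].
rewrite /F (count_seqs_count _ uL) //; first exact: FP.
(* A sequence counted by [F] is in [L], being the first half of its completion. *)
move=> t /and5P[/eqP sz srt /forallP partial /eqP lastE /eqP sumT].
rewrite -(take_complete sz); apply: map_f; rewrite lP.
apply: complete_scs => //; first by rewrite lastE -ltnS.
move=> r; rewrite leq_eqVlt => /predU1P[->|ltr]; first by rewrite sumT.
have := partial (Ordinal ltr); case: r ltr => [|r] ltr /=; first by rewrite bin0n.
exact.
Qed.

Theorem theorem6 (m : nat) (hm : 1 <= m) :
  SCS (2 * m) =
    \sum_('C(m, 2) <= T < (m * (m - 1)).+1)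
      \sum_(ceil_div T m <= E < (m - 1).+1) F m T E
  /\
  SCS (2 * m + 1) =
    \sum_('C(m, 2) <= T < (m ^ 2).+1)
      \sum_(ceil_div T m <= E < m.+1) F m T E.
Proof.
split; rewrite SCS_half; try lia.
  have -> : (2 * m)./2 = m by lia.
  by have -> : (2 * m).-1./2 = m - 1 by lia.
have -> : (2 * m + 1)./2 = m by lia.
by have -> : (2 * m + 1).-1./2 = m by lia.
Qed.
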